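(* Let $m\ge 1$, $n>1$ and $p\ge 3$ be integers. Then $\theta(mC_p[\bar{K_n}])=0$ if $n$ is even, or $mnp$ is odd, or $n$ is odd and $p\equiv 0\pmod 4$; and $\theta(mC_p[\bar{K_n}])=1$ otherwise.
   Context: $C_p$ is the cycle on $p$ vertices and $\bar{K_n}$ is the edgeless graph on $n$ vertices. For graphs $G,H$, the lexicographic product $G[H]$ has vertex set $V(G)\times V(H)$, with $(g,h)$ adjacent to $(g',h')$ iff $gg'\in E(G)$, or $g=g'$ and $hh'\in E(H)$. $mC_p[\bar{K_n}]$ denotes the disjoint union of $m$ copies of $C_p[\bar{K_n}]$. For a finite set $S$ of positive integers with $|S|=|V(G)|$, a graph $G$ is $S$-magic if there is a bijection $f:V(G)\to S$ and a constant $c$ with $\sum_{v\in N(u)} f(v)=c$ for every vertex $u$, where $N(u)$ is the set of neighbours of $u$. Let $\alpha(S)=\max S$ and $i(G)=\min \alpha(S)$ over all $S$ for which $G$ is $S$-magic; the distance magic index is $\theta(G)=i(G)-|V(G)|$ (and $\theta(G)=\infty$ if no such $S$ exists). *)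

(* Defs.v *)
From mathcomp Require Import all_boot all_order all_algebra.
From mathcomp Require Import finmap.
From mathcomp Require Import boolp constructive_ereal.

Set Implicit Arguments.
Unset Strict Implicit.
Unset Printing Implicit Defensive.

Record sgraph : Type := SGraph {
  vertex :> finType;
  adj : rel vertex;
  adj_sym : symmetric adj;
  adj_irrefl : irreflexive adj
}.
Arguments adj {s} _ _.

Section Cycle.
Variable p : nat.

(* The clause i != j only matters for p = 1, where i would be its own
   successor modulo p. *)
Definition cycle_adj : rel 'I_p :=
  fun i j => (i != j) && ((j == i.+1 %% p :> nat) || (i == j.+1 %% p :> nat)).

Lemma cycle_adj_sym : symmetric cycle_adj.
Proof. by move=> i j; rewrite /cycle_adj eq_sym orbC. Qed.

Lemma cycle_adj_irrefl : irreflexive cycle_adj.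
Proof. by move=> i; rewrite /cycle_adj eqxx. Qed.

Definition cycle_graph : sgraph := SGraph cycle_adj_sym cycle_adj_irrefl.
End Cycle.

Section Edgeless.
Variable n : nat.

Definition edgeless_adj : rel 'I_n := fun _ _ => false.

Lemma edgeless_adj_sym : symmetric edgeless_adj.
Proof. by []. Qed.

Lemma edgeless_adj_irrefl : irreflexive edgeless_adj.
Proof. by []. Qed.

Definition edgeless : sgraph := SGraph edgeless_adj_sym edgeless_adj_irrefl.
End Edgeless.

Section Lexicographic.
Variables G H : sgraph.

Definition lex_adj : rel (G * H)%type :=
  fun x y => adj x.1 y.1 || ((x.1 == y.1) && adj x.2 y.2).

Lemma lex_adj_sym : symmetric lex_adj.
Proof.
move=> x y; rewrite /lex_adj adj_sym eq_sym; congr (_ || (_ && _)).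
exact: adj_sym.
Qed.

Lemma lex_adj_irrefl : irreflexive lex_adj.
Proof. by move=> x; rewrite /lex_adj !adj_irrefl andbF. Qed.

Definition lex_product : sgraph := SGraph lex_adj_sym lex_adj_irrefl.
End Lexicographic.

Section Copies.
Variables (m : nat) (G : sgraph).

Definition copies_adj : rel ('I_m * G)%type :=
  fun x y => (x.1 == y.1) && adj x.2 y.2.

Lemma copies_adj_sym : symmetric copies_adj.
Proof. by move=> x y; rewrite /copies_adj eq_sym adj_sym. Qed.

Lemma copies_adj_irrefl : irreflexive copies_adj.
Proof. by move=> x; rewrite /copies_adj adj_irrefl andbF. Qed.

Definition copies : sgraph := SGraph copies_adj_sym copies_adj_irrefl.
End Copies.

Definition S_magic (G : sgraph) (S : {fset nat}) : Prop :=
  [/\ forall x, x \in S -> 0 < x,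
      #|` S| = #|G| &
      exists (f : G -> S) (c : nat),
        bijective f /\ forall u : G, \sum_(v | adj u v) fsval (f v) = c].

Definition alpha (S : {fset nat}) : nat := \max_(x <- S) x.

Definition magic_max (G : sgraph) (a : nat) : Prop :=
  exists S : {fset nat}, S_magic G S /\ alpha S = a.

(* i(G), with value +oo when G is not S-magic for any S. *)
Definition magic_number (G : sgraph) : \bar int :=
  if pselect (exists a, `[< magic_max G a >]) is left ex
  then (Posz (ex_minn ex))%:E else +oo%E.

(* The subtraction is in the integers extended with infinities, so it is not
   truncated. *)
Definition distance_magic_index (G : sgraph) : \bar int :=
  (magic_number G - (Posz #|G|)%:E)%E.

(* Main.v *)
Require Import Defs.
From mathcomp Require Import all_boot all_order all_algebra.
From mathcomp Require Import finmap boolp.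
From mathcomp Require Import constructive_ereal.
From mathcomp Require Import zify.

(** Let k = m p be the number of fibres (copies of the n independent vertices),
    and write s_i for the label sum of fibre i of a copy of the cycle. A
    labelling is magic iff s_i + s_(i+2) = c for all i, in every copy; hence
    s_i = s_(i+4), and if 4 does not divide p all s_i equal c/2.  With labels
    1 .. kn this common value is n (kn + 1) / 2, not an integer when n is odd
    and k is even, so the index is then at least 1.

    Labellings come from an n x k array with row r containing the labels
    rk + 1 .. rk + k. Two consecutive rows, one increasing and one decreasing,
    contribute equally to all columns; this settles n even. For n odd, the
    first three rows are x, a row of slope -2 and a half-turn of x: the column
    sums are constant if k is odd, and if k is even they take two values
    differing by 1, on the two halves of the columns. If 4 divides p, the fibres
    with i mod 4 < 2 are assigned to one half and the others to the other half.
    Otherwise, shifting by 1 every label above k/2 leaves exactly one label of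
    each column of the first half unchanged, which equalises the two sums. *)

(** * Label sets and the distance magic index *)

Lemma le_alpha (S : {fset nat}) x : x \in S -> x <= alpha S.
Proof. by move=> xS; exact: (@leq_bigmax_seq _ _ xpredT id x xS isT). Qed.

Lemma alpha_le (S : {fset nat}) M :
  (forall x, x \in S -> x <= M) -> alpha S <= M.
Proof. by move=> h; apply/bigmax_leqP_seq => x /h. Qed.

Lemma S_magic_sub_iota (G : sgraph) (S : {fset nat}) :
  S_magic G S -> {subset S <= iota 1 (alpha S)}.
Proof.
case=> pos _ _ x xS; rewrite mem_iota; move: (pos _ xS) (le_alpha _ _ xS); lia.
Qed.

Lemma magic_max_ge_card (G : sgraph) a : magic_max G a -> #|G| <= a.
Proof.
case=> S [mS <-]; case: (mS) => _ <- _.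
rewrite -(size_iota 1 (alpha S)).
exact: uniq_leq_size (S_magic_sub_iota _ _ mS).
Qed.

Lemma double_sum_iota1 N : (\sum_(x <- iota 1 N) x) * 2 = N * N.+1.
Proof.
elim: N => [|N IH]; first by rewrite big_nil.
by rewrite -[in iota _ _](addn1 N) iotaD big_cat big_seq1 /= mulnDl IH; lia.
Qed.

(** With largest label [#|G|], the set [S] fills [iota 1 #|G|], which fixes the total of the
    labels. *)
Lemma magic_max_card_sum (G : sgraph) : magic_max G #|G| ->
  exists (g : G -> nat) (c : nat),
    (forall u, \sum_(v | adj u v) g v = c) /\
    (\sum_v g v) * 2 = #|G| * #|G|.+1.
Proof.
case=> S [mS aS]; case: (mS) => _ cS [f [c [fbij fc]]].
exists (fun v => fsval (f v)), c; split => //.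
rewrite -(reindex f (P := predT) (F := fun y : S => fsval y)) /=; last first.
  by apply: onW_bij.
rewrite -(big_seq_fsetE _ _ predT id) /= -double_sum_iota1; congr (_ * 2).
apply: perm_big; apply: uniq_perm; rewrite ?iota_uniq ?fset_uniq //.
have sub := S_magic_sub_iota _ _ mS; rewrite aS in sub.
have size_le : size (iota 1 #|G|) <= size S by rewrite size_iota -cS.
by have [] := uniq_min_size (fset_uniq S) sub size_le.
Qed.

(** A bound [M] suffices: the lower bounds on the largest label later force equality. *)
Lemma magic_max_of_labelling (G : sgraph) (g : G -> nat) M c :
  injective g -> (forall v, 0 < g v <= M) ->
  (forall u, \sum_(v | adj u v) g v = c) ->
  exists2 a, a <= M & magic_max G a.
Proof.
move=> ginj gM gc.
pose S : {fset nat} := [fset x in codom g]%fset.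
have gS v : g v \in S by rewrite in_fset /= codom_f.
have SP x : x \in S -> 0 < x <= M.
  by rewrite in_fset /= => /codomP[v ->].
have cS : #|` S| = #|G|.
  rewrite card_fseq undup_id ?size_codom //.
  by apply/injectiveP.
exists (alpha S); first by apply: alpha_le => x /SP /andP[].
exists S; split=> //; split=> //; first by move=> x /SP /andP[].
exists (fun v => [` gS v]%fset), c; split=> //.
apply: inj_card_bij; first by move=> u v /(congr1 val) /= /ginj.
by rewrite -cardfE cS.
Qed.

Lemma distance_magic_indexE (G : sgraph) d :
  magic_max G (#|G| + d) ->
  (forall b, magic_max G b -> #|G| + d <= b) ->
  distance_magic_index G = (Posz d)%:E.
Proof.
move=> mG minG; rewrite /distance_magic_index /magic_number.
case: pselect => [ex|[]]; last by exists (#|G| + d); apply/asboolP.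
case: ex_minnP => a /asboolP ma amin.
have -> : a = #|G| + d.
  apply/eqP; rewrite eqn_leq (minG _ ma) andbT.
  by apply: amin; apply/asboolP.
rewrite -EFinB; congr EFin; lia.
Qed.

(** * Neighbour sums as sums over two fibres *)

Definition mCpKn m n p := copies m (lex_product (cycle_graph p) (edgeless n)).

Lemma card_mCpKn m n p : #|mCpKn m n p| = m * p * n.
Proof. by rewrite /= !card_prod !card_ord mulnA. Qed.

Definition fiber_sum m n p (g : mCpKn m n p -> nat) (u : 'I_m) (i : 'I_p) :=
  \sum_(r < n) g (u, (i, r)).

Lemma ordS_val p (i : 'I_p) : ordS i = (if i.+1 < p then i.+1 else 0) :> nat.
Proof.
have := ltn_ord i; rewrite /= leq_eqVlt => /orP[/eqP->|ip].
  by rewrite modnn ltnn.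
by rewrite ip modn_small.
Qed.

Lemma ord_pred_val p (i : 'I_p) :
  ord_pred i = (if i == 0 :> nat then p.-1 else i.-1) :> nat.
Proof.
have ip := ltn_ord i; rewrite /=; case: eqP => [->|i0].
  by rewrite modn_small //; lia.
by rewrite -[in LHS](@prednK i) ?lt0n ?addSn /= ?modnDr ?modn_small //; lia.
Qed.

Lemma cycle_adjE p (i j : 'I_p) : 2 < p ->
  cycle_adj i j = (j == ordS i) || (j == ord_pred i).
Proof.
move=> p2; rewrite /cycle_adj -!val_eqE /=.
move: (ordS_val p i) (ordS_val p j) (ord_pred_val p i) => /= -> -> ->.
by move: (ltn_ord i) (ltn_ord j); do !case: ifP => ?; lia.
Qed.

Lemma neighbour_sumE m n p (g : mCpKn m n p -> nat) u i r : 2 < p ->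
  \sum_(v | adj ((u, (i, r)) : mCpKn m n p) v) g v
  = fiber_sum m n p g u (ord_pred i) + fiber_sum m n p g u (ordS i).
Proof.
move=> p2.
transitivity (\sum_(a | a == u) \sum_(b : 'I_p * 'I_n | cycle_adj i b.1)
   g (a, b)).
  rewrite pair_big_dep /=; apply: eq_big => [[a [b c]]|[a [b c]] _] //=.
  by rewrite /copies_adj /= /lex_adj /= /edgeless_adj andbF orbF eq_sym.
rewrite big_pred1_eq.
transitivity (\sum_(j | cycle_adj i j) fiber_sum m n p g u j).
  rewrite /fiber_sum pair_big_dep /=.
  by apply: eq_big => [[a b]|[a b] _] //=; rewrite andbT.
rewrite (bigD1 (ord_pred i)) /=; last by rewrite cycle_adjE ?eqxx ?orbT.
congr (_ + _); apply: big_pred1 => j; rewrite cycle_adjE //=.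
(* As [2 < p], predecessor and successor differ, so no fibre is counted twice. *)
have [->|//] := eqVneq j (ordS i); last by rewrite /= andbN.
rewrite -val_eqE; move: (ordS_val p i) (ord_pred_val p i) => /= -> ->.
by move: (ltn_ord i); do !case: ifP => ?; lia.
Qed.

(** * The array of labels and its column sums *)

(* [o] is the parity of the number of rows; [x] is the column. *)
Definition row k (o : bool) r x :=
  if o && (r < 3) then
    match r with
    | 0 => x
    | 1 => if x.*2 < k then k.-1 - x.*2 else k.*2 - (~~ odd k).+1 - x.*2
    | _ => if x + k./2 < k then x + k./2 else x + k./2 - k
    end
  else if odd r then x else k.-1 - x.

Definition label k o x r := (r * k + row k o r x).+1.

Lemma row_lt k o r x : x < k -> row k o r x < k.
Proof.
move=> xk; rewrite /row; case: ifP => _; last by case: ifP => _; lia.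
case: r => [|[|r]] //; case: ifP => ?; lia.
Qed.

(** The row of slope -2 runs through one parity class on the first half of the columns and the other
    class on the second. *)
Lemma row_inj k o r x y : x < k -> y < k ->
  row k o r x = row k o r y -> x = y.
Proof.
move=> xk yk; rewrite /row; case: ifP => _; last by case: ifP => _; lia.
case: r => [|[|r]] //; case: ifP => ?; case: ifP => ?; lia.
Qed.

Lemma label_inj k o x y r t : x < k -> y < k ->
  label k o x r = label k o y t -> x = y /\ r = t.
Proof.
move=> xk yk [E].
have k0 : 0 < k by lia.
have rt : r = t.
  move: (congr1 (divn^~ k) E).
  by rewrite /= !divnMDl // !divn_small ?addn0 ?row_lt.
by split=> //; rewrite -rt in E; move/addnI: E => /row_inj; apply.
Qed.

Lemma label_bounds k o x r n : x < k -> r < n -> 0 < label k o x r <= k * n.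
Proof. by move=> xk rn; rewrite /label /=; move: (row_lt k o r _ xk); nia. Qed.

Lemma row_sum_even k x q : x < k -> \sum_(r < q.*2) row k false r x = q * k.-1.
Proof.
move=> xk; elim: q => [|q IH]; first by rewrite big_ord0.
rewrite doubleS !big_ord_recr /= IH /row /= odd_double /=; lia.
Qed.

(** Rows 1 and 2 break at the same column, since [x.*2 < k] iff [x + k./2 < k], so the slopes 1, -2,
    1 cancel on each half. The boolean makes up the deficit of 1 on the upper half for even [k]. *)
Lemma row_sum_odd k x q : x < k ->
  \sum_(r < q.*2.+3) row k true r x + (~~ odd k && (k./2 <= x))
  = 3 * k./2 - ~~ odd k + q * k.-1.
Proof.
move=> xk; elim: q => [|q IH].
  rewrite !big_ord_recr big_ord0 /= /row /=.
  by case: ifP => ?; case: ifP => ?; lia.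
rewrite doubleS 2!big_ord_recr /= addnAC -addnA addnAC addnA IH.
by rewrite /row /= odd_double /=; lia.
Qed.

Lemma label_sum n k : 1 < n -> exists D, forall x, x < k ->
  \sum_(r < n) label k (odd n) x r + (odd n && ~~ odd k && (k./2 <= x)) = D.
Proof.
move=> n1.
have split_sum x : \sum_(r < n) label k (odd n) x r =
    \sum_(r < n) (r * k).+1 + \sum_(r < n) row k (odd n) r x.
  by rewrite -big_split; apply: eq_bigr.
case: (boolP (odd n)) split_sum => on split_sum.
  have En : n = ((n - 3)./2).*2.+3 by lia.
  exists (\sum_(r < n) (r * k).+1 + (3 * k./2 - ~~ odd k + (n - 3)./2 * k.-1)).
  move=> x xk; rewrite split_sum -addnA; congr (_ + _).
  by move: (row_sum_odd k x (n - 3)./2 xk); rewrite -En.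
have En : n = (n./2).*2 by lia.
exists (\sum_(r < n) (r * k).+1 + n./2 * k.-1) => x xk.
by rewrite split_sum addn0; move: (row_sum_even k x n./2 xk); rewrite -En => ->.
Qed.

(** * Two corrections for an even number of columns *)

Definition skip k l := l + (k./2 < l).

(** Row 0 has label [x.+1], shifted iff [k./2 <= x]; the labels of the other [n.-1] rows exceed [k]
    and are all shifted. *)
Lemma skip_label_sum n k x : odd n -> x < k ->
  \sum_(r < n) skip k (label k true x r)
  = \sum_(r < n) label k true x r + (n.-1 + (k./2 <= x)).
Proof.
case: n => // n _ xk; rewrite /skip big_split /=; congr (_ + _).
rewrite big_ord_recl addnC; congr (_ + _).
rewrite -[RHS]card_ord -sum1_card; apply: eq_bigr => r _.
have -> // : k./2 < label k true x (lift ord0 r).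
by rewrite /label /= /bump /=; nia.
Qed.

(** For [4 %| k], a permutation of the columns that puts [j] and [j + 2] in opposite halves. *)
Definition interleave k j :=
  if j %% 4 < 2 then j %/ 4 * 2 + j %% 4 else k./2 + j %/ 4 * 2 + j %% 4 - 2.

Lemma interleave_lt k j : 4 %| k -> j < k -> interleave k j < k.
Proof. by rewrite /interleave => dk jk; case: ifP => ?; lia. Qed.

Lemma interleave_inj k i j : 4 %| k -> i < k -> j < k ->
  interleave k i = interleave k j -> i = j.
Proof.
by rewrite /interleave => dk ik jk; case: ifP => ?; case: ifP => ?; lia.
Qed.

Lemma half_le_interleave k j : 4 %| k -> j < k ->
  (k./2 <= interleave k j) = (1 < j %% 4).
Proof. by rewrite /interleave => dk jk; case: ifP => ?; lia. Qed.

(** * From arrays to magic labellings *)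

Lemma ordSS_val p (i : 'I_p) : 2 < p ->
  ordS (ordS i) = (if i.+2 < p then i.+2 else i.+2 - p) :> nat.
Proof.
move=> p2; rewrite !ordS_val; move: (ltn_ord i).
by case: (ltnP i.+1 p) => ? ?; do !case: ifP => ?; lia.
Qed.

Lemma flat_index_lt m p (u : 'I_m) (i : 'I_p) : u * p + i < m * p.
Proof. by move: (ltn_ord u) (ltn_ord i); nia. Qed.

(** Fibre [i] of copy [u] receives column [phi (u * p + i)], relabelled by [s]. The last hypothesis
    is the magic condition at fibre [ordS i]. *)
Lemma magic_max_of_fibers m n p (phi : nat -> nat) (s : nat -> nat) M c :
  2 < p ->
  (forall j, j < m * p -> phi j < m * p) ->
  (forall i j, i < m * p -> j < m * p -> phi i = phi j -> i = j) ->
  injective s ->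
  (forall l, 0 < l <= m * p * n -> 0 < s l <= M) ->
  let F j := \sum_(r < n) s (label (m * p) (odd n) (phi j) r) in
  (forall (u : 'I_m) (i : 'I_p),
     F (u * p + i) + F (u * p + ordS (ordS i)) = c) ->
  exists2 a, a <= M & magic_max (mCpKn m n p) a.
Proof.
move=> p2 phi_lt phi_inj s_inj sM F Fc.
pose g (v : mCpKn m n p) :=
  s (label (m * p) (odd n) (phi (v.1 * p + v.2.1)) v.2.2).
apply: (magic_max_of_labelling _ g M c).
- move=> [u [i r]] [u' [i' r']] /s_inj /label_inj[];
    rewrite ?phi_lt ?flat_index_lt //=.
  move=> /phi_inj E /val_inj ->.
  have {}E := E (flat_index_lt _ _ _ _) (flat_index_lt _ _ _ _).
  have Eu : u = u'.
    apply: val_inj; move: (congr1 (divn^~ p) E).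
    by rewrite /= !divnMDl ?divn_small ?addn0 //; lia.
  by rewrite -Eu in E *; move/addnI: E => /val_inj ->.
- by move=> [u [i r]]; apply: sM; apply: label_bounds;
  rewrite ?phi_lt ?flat_index_lt.
- move=> [u [i r]]; rewrite neighbour_sumE // -(Fc u (ord_pred i)) ord_predK.
  by [].
Qed.

(** * The parity obstruction *)

Lemma iter_ordS_val p (i : 'I_p) j : iter j (@ordS p) i = (i + j) %% p :> nat.
Proof.
elim: j => [|j IH]; first by rewrite addn0 modn_small.
by rewrite iterS /= IH -addn1 modnDml -addnA addn1.
Qed.

Lemma two_step_constant p (t : 'I_p -> nat) c : p != 0 %[mod 4] ->
  (forall i, t i + t (ordS (ordS i)) = c) -> forall i, t i * 2 = c.
Proof.
move=> p4 tc i; pose T j := t (iter j (@ordS p) i).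
have T2 j : T j + T j.+2 = c by apply: tc.
have T4 q : T (q * 4 + 2) = T 2.
  elim: q => [//|q IH]; rewrite -IH.
  have -> : q.+1 * 4 + 2 = (q * 4 + 2).+4 by lia.
  by move: (T2 (q * 4 + 2)) (T2 (q * 4 + 2).+2); lia.
have Tp w : T (p * w) = T 0.
  congr t; apply: val_inj.
  by rewrite /= iter_ordS_val mulnC addnC modnMDl modn_small.
have T20 : T 2 = T 0.
  (* The multiple of [p] used is [2p] for odd [p] and [p] otherwise; both are 2 modulo 4. *)
  rewrite -(Tp (odd p).+1) -(T4 (p * (odd p).+1 %/ 4)); congr T.
  by case: (boolP (odd p)) => op; lia.
by move: (T2 0); rewrite T20 /T /=; lia.
Qed.

(** Counting twice the total gives [c = n * (m * p * n).+1], which is odd, whereas [c] is twice a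
    fibre sum. *)
Lemma not_magic_max_card m n p : 0 < m -> 2 < p -> odd n -> ~~ odd (m * p) ->
  p != 0 %[mod 4] -> ~ magic_max (mCpKn m n p) #|mCpKn m n p|.
Proof.
move=> m0 p2 on emp p4 /magic_max_card_sum[g [c [gc]]]; rewrite card_mCpKn.
have n0 : 0 < n by case: (n) on.
have fiberE u i : fiber_sum m n p g u i * 2 = c.
  apply: two_step_constant p4 _ i => i.
  by rewrite -(gc (u, (ordS i, Ordinal n0))) neighbour_sumE // ordSK.
have -> : \sum_v g v = \sum_u \sum_i fiber_sum m n p g u i.
  rewrite /fiber_sum; under [RHS]eq_bigr do rewrite pair_bigA /=.
  by rewrite pair_bigA /=; apply: eq_bigr => [[u [i r]]].
rewrite big_distrl /=; under eq_bigr => u _.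
  rewrite big_distrl /=; under eq_bigr do rewrite fiberE.
  rewrite sum_nat_const card_ord; over.
rewrite sum_nat_const card_ord mulnA -[RHS]mulnA => /eqP.
have mp0 : 0 < m * p by rewrite muln_gt0 m0; lia.
rewrite eqn_pmul2l // => /eqP cE.
have : odd c by rewrite cE oddM on oddS oddM (negPf emp).
have p0 : 0 < p by lia.
by rewrite -(fiberE (Ordinal m0) (Ordinal p0)) oddM andbF.
Qed.

(** * Upper bounds and the value of the index *)

Lemma magic_max_le_card m n p : 0 < m -> 1 < n -> 2 < p ->
  ~~ odd n \/ odd (m * n * p) \/ (odd n /\ p = 0 %[mod 4]) ->
  exists2 a, a <= m * p * n & magic_max (mCpKn m n p) a.
Proof.
move=> m0 n1 p2 C; have [D DE] := label_sum n (m * p) n1.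
have [C1|[on p4]] : ~~ odd n || odd (m * p) \/ odd n /\ p = 0 %[mod 4].
  case: C => [->|[|]]; first by left.
    by rewrite !oddM => /andP[/andP[-> _] ->]; left; rewrite orbT.
  by right.
  have C2 : odd n && ~~ odd (m * p) = false by move: C1; case: odd; case: odd.
  apply: (magic_max_of_fibers m n p id id _ (D + D)) => // u i.
  have DE' x := DE x; rewrite C2 in DE'.
  by congr (_ + _); rewrite -[LHS]addn0; apply: DE'; apply: flat_index_lt.
have pd4 : 4 %| p by rewrite /dvdn p4.
have d4 : 4 %| m * p by apply: dvdn_mull.
(* Exactly one of the fibres [i] and [i + 2] lies in the upper half, with sum [D.-1]. *)
apply: (magic_max_of_fibers m n p (interleave (m * p)) id _ (D + D).-1) => //.
- by move=> j; apply: interleave_lt.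
- by move=> i j; apply: interleave_inj.
move=> u i.
have FE (j : 'I_p) := DE _ (interleave_lt _ _ d4 (flat_index_lt m p u j)).
have en : ~~ odd (m * p) by lia.
have {}FE (j : 'I_p) :
    \sum_(r < n) label (m * p) (odd n) (interleave (m * p) (u * p + j)) r
    + (1 < j %% 4) = D.
  rewrite -[RHS](FE j) on en half_le_interleave ?flat_index_lt //=.
  congr (_ + (_ < _)).
  by rewrite -modnDml; move/eqP: (dvdn_mull u pd4) => ->.
move: (FE i) (FE (ordS (ordS i))); rewrite ordSS_val // => <-.
(* Wrapping around subtracts [p], which preserves residues modulo 4. *)
by case: ifP => ?; lia.
Qed.

Lemma magic_max_le_cardS m n p : 0 < m -> 1 < n -> 2 < p ->
  odd n -> ~~ odd (m * p) ->
  exists2 a, a <= (m * p * n).+1 & magic_max (mCpKn m n p) a.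
Proof.
move=> m0 n1 p2 on emp; have [D DE] := label_sum n (m * p) n1.
rewrite on emp /= in DE.
(* Lower columns go from [D] up by [n.-1], upper ones from [D.-1] up by [n]: every fibre sums to
   [D + n.-1]. *)
apply: (magic_max_of_fibers m n p id (skip (m * p)) _
  ((D + n.-1) + (D + n.-1))) => //.
- by move=> x y; rewrite /skip; lia.
- by move=> l; rewrite /skip; lia.
move=> u i.
have FE (j : 'I_p) :
    \sum_(r < n) skip (m * p) (label (m * p) (odd n) (u * p + j) r)
    = D + n.-1.
  by rewrite on skip_label_sum ?flat_index_lt //
    -(DE _ (flat_index_lt m p u j)) (addnC n.-1) addnA.
by rewrite !FE.
Qed.

Theorem theorem14 (m n p : nat) (hm : 1 <= m) (hn : 1 < n) (hp : 3 <= p) :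
  let theta :=
    distance_magic_index (copies m (lex_product (cycle_graph p) (edgeless n))) in
  let C :=
    ~~ odd n \/ odd (m * n * p) \/ (odd n /\ p = 0 %[mod 4]) in
  (C -> theta = 0%:E) /\ (~ C -> theta = 1%:E).
Proof.
move=> theta C; rewrite /theta -/(mCpKn m n p).
have ge_card := magic_max_ge_card (mCpKn m n p).
split=> [c|nc].
  have [a le_a ma] := magic_max_le_card m n p hm hn hp c.
  apply: (distance_magic_indexE _ 0) => [|b /ge_card]; rewrite addn0 //.
  suff <- : a = #|mCpKn m n p| by [].
  by apply/eqP; rewrite eqn_leq ge_card // card_mCpKn le_a.
have on : odd n by apply/negPn/negP => on; apply: nc; left.
have p4 : p != 0 %[mod 4] by apply/eqP => p4; apply: nc; right; right.
have emp : ~~ odd (m * p).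
  by apply/negP => omp; apply: nc; right; left; rewrite mulnAC oddM omp.
have gt_card b : magic_max (mCpKn m n p) b -> #|mCpKn m n p| < b.
  move=> mb; rewrite ltn_neqAle ge_card // andbT; apply/eqP => E.
  by apply: (not_magic_max_card m n p) => //; rewrite E.
have [a le_a ma] := magic_max_le_cardS m n p hm hn hp on emp.
apply: (distance_magic_indexE _ 1) => [|b /gt_card]; rewrite addn1 //.
suff <- : a = #|mCpKn m n p|.+1 by [].
by apply/eqP; rewrite eqn_leq gt_card // card_mCpKn le_a.
Qed.
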